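(* $P(6,3)\leq 116$, $P(7,3)\leq 716$, $P(11,3)\leq 10!-10$, $P(13,3)\leq 12!-12$, and $P(17,3)\leq 16!-5$.
   Context: $S_n$ denotes the set of all permutations of $[n]=\{1,\dots,n\}$. The Kendall $\tau$-distance $d_K(\rho,\pi)$ between $\rho,\pi\in S_n$ is the minimum number of adjacent transpositions $(i,i+1)$ ($1\leq i\leq n-1$) whose product equals $\rho\pi^{-1}$. $P(n,d)$ denotes the maximum size of a subset $C\subseteq S_n$ such that $d_K(x,y)\geq d$ for all distinct $x,y\in C$. *)

(* Defs.v *)
From mathcomp Require Import all_boot all_order all_fingroup.
Set Implicit Arguments. Unset Strict Implicit. Unset Printing Implicit Defensive.

Local Open Scope group_scope.

(* [n] = {1,...,n} is represented by 'I_n = {0,...,n-1}; S_n is 'S_n. *)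

Definition adj_transp (n : nat) (s : 'S_n) : bool :=
  [exists i : 'I_n, exists j : 'I_n, (val j == (val i).+1) && (s == tperm i j)].

(* Product of a word t_1 ... t_k as functions, t_1 o t_2 o ... o t_k.
   MathComp's perm product is (s * t) x = t (s x), i.e. s * t = t o s,
   so t_1 o ... o t_k is \prod over the reversed word. *)
Definition word_prod (n : nat) (w : seq 'S_n) : 'S_n := \prod_(t <- rev w) t.

(* rho o pi^{-1} (function composition) in MathComp's product convention. *)
Definition comp_inv (n : nat) (rho pi : 'S_n) : 'S_n := pi^-1 * rho.

Definition adj_word_of_length (n : nat) (k : nat) (g : 'S_n) : Prop :=
  exists w : seq 'S_n, [/\ size w = k, all (@adj_transp n) w & word_prod w = g].

(* d_K(rho, pi) >= d, where d_K(rho,pi) is the minimum number of adjacent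
   transpositions whose product equals rho pi^{-1}: no such product of
   fewer than d adjacent transpositions exists. *)
Definition kendall_ge (n : nat) (rho pi : 'S_n) (d : nat) : Prop :=
  forall k, k < d -> ~ adj_word_of_length k (comp_inv rho pi).

Definition kendall_code (n : nat) (C : {set 'S_n}) (d : nat) : Prop :=
  forall x y, x \in C -> y \in C -> x != y -> kendall_ge x y d.

Definition P_le (n d M : nat) : Prop :=
  forall C : {set 'S_n}, kendall_code C d -> #|C| <= M.

(* Main.v *)
(* Right multiplication by the adjacent transpositions and the identity turns a code of distance 3
   into a packing of S_n by balls of size n; let U be the set of uncovered elements, so that
   |U| = n! - n|C|, and it suffices to show that U is large.

   For n = 6 and n = 7 the packing has a local defect: there is a set W of 78 (resp. 162)
   permutations such that every translate gW contains at least 2 (resp. 1) uncovered elements,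
   which is established by a finite branching on how the elements of W get covered. Summing over g
   gives k n! <= |W| |U|.

   For n prime, n >= 9, fix two points and let x(i,j) be the number of codewords sending them to
   (i,j). The balls give, for each (i,j), that the sum of x over its n images is at most (n-2)!,
   which is 1 modulo n by Wilson. Subtracting ((n-2)!-1)/n from x yields integers u(i,j) whose ball
   sums are at most 1, and all but at most 4 of the n terms of a ball sum equal u(i,j) itself.
   A positive value thus forces so much negative mass around it that the sum of u is at most 0,
   i.e. |C| <= (n-1)! - (n-1). *)
Require Import Defs.
From mathcomp Require Import all_boot all_order all_fingroup all_algebra zify.
Set Implicit Arguments. Unset Strict Implicit. Unset Printing Implicit Defensive.
Import Order.TTheory GRing.Theory Num.Theory.

(** * Unit balls *)

Local Open Scope group_scope.

(* For [a = m] this is the identity, so that the unit ball around [g] is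
   [{g * tau m a | a < m.+1}]. *)
Definition tau m (a : nat) : 'S_m.+1 :=
  if a < m then tperm (inord a) (inord a.+1) else 1.

Lemma tauV m a : (tau m a)^-1 = tau m a.
Proof. by rewrite /tau; case: ifP => _; rewrite ?tpermV ?invg1. Qed.

Lemma tauK m a (g : 'S_m.+1) : g * tau m a * tau m a = g.
Proof. by rewrite -{2}tauV mulgK. Qed.

Lemma val_tau m a (i : 'I_m.+1) :
  a < m -> tau m a i = (if i == a :> nat then a.+1 else if i == a.+1 :> nat then a else i) :> nat.
Proof.
move=> am; rewrite /tau am; case: tpermP => [->|->|/eqP + /eqP].
- by rewrite !inordK ?eqxx //; lia.
- by rewrite !inordK ?eqxx; try case: eqP; lia.
by rewrite -!val_eqE /= !inordK; do ?case: eqP; lia.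
Qed.

Lemma tau_eq1 m a : (tau m a == 1) = (m <= a).
Proof.
have [ma|am] := leqP m a; first by rewrite /tau ltnNge ma eqxx.
apply/eqP => /permP /(_ (inord a)) /(congr1 val) /=.
by rewrite val_tau // perm1 inordK ?eqxx; lia.
Qed.

Lemma adj_transp_tau m a : a < m -> adj_transp (tau m a).
Proof.
move=> am; apply/existsP; exists (inord a); apply/existsP; exists (inord a.+1).
by rewrite /= /tau am !inordK ?eqxx //; lia.
Qed.

Lemma tau_inj m (a b : 'I_m.+1) : tau m a = tau m b -> a = b.
Proof.
move=> eq_ab; apply: val_inj => /=.
have [ma|am] := leqP m a.
  have := tau_eq1 m b; rewrite -eq_ab tau_eq1 ma; move: (ltn_ord a) (ltn_ord b); lia.
have bm : b < m by rewrite ltnNge -tau_eq1 -eq_ab tau_eq1 -ltnNge.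
have := congr1 (fun s : 'S_m.+1 => val (s a)) eq_ab; rewrite /= !val_tau // eqxx.
by do !case: ifP; lia.
Qed.

(** Two members of the unit ball around [g] differ by [tau m b * tau m a], hence by at most two
    adjacent transpositions, which distance 3 forbids for distinct codewords. *)
Lemma code_ball_disjoint m (C : {set 'S_m.+1}) (g : 'S_m.+1) (a b : 'I_m.+1) :
  kendall_code C 3 -> g * tau m a \in C -> g * tau m b \in C -> a = b.
Proof.
move=> codeC Ca Cb; apply/eqP; apply: contraT => neq_ab.
have neq_g : g * tau m a != g * tau m b.
  by apply: contraNneq neq_ab => /mulgI /tau_inj ->.
(* [tau m m] is the identity and not an adjacent transposition, so trivial factors are dropped from
   the word. *)
pose w := [seq t <- [:: tau m a; tau m b] | t != 1].
have w_lt3 : size w < 3.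
  by rewrite ltnS size_filter (leq_trans (count_size _ _)).
case: (codeC _ _ Ca Cb neq_g _ w_lt3); exists w; split => //.
  rewrite /w /= !tau_eq1.
  by do 2!case: (leqP m) => ? //=; rewrite ?adj_transp_tau.
rewrite /word_prod /comp_inv invMg tauV -mulgA mulKg /w /=.
by do 2!case: eqP => [->|_] /=; rewrite /rev /= ?big_cons big_nil ?mulg1 ?mul1g.
Qed.

Definition uncovered m (C : {set 'S_m.+1}) : {set 'S_m.+1} :=
  [set g | [forall a : 'I_m.+1, g * tau m a \notin C]].

Lemma sum_ball m (C : {set 'S_m.+1}) (g : 'S_m.+1) :
  kendall_code C 3 -> \sum_(a < m.+1) (g * tau m a \in C)%g = (g \notin uncovered C).
Proof.
move=> codeC; rewrite inE; case: forallP => [g_out|].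
  by rewrite big1 // => a _; rewrite (negbTE (g_out a)).
move/forallP/forallPn => [a]; rewrite negbK => Ca.
rewrite (bigD1 a) //= Ca big1 // => b /eqP neq_ba.
by case: (boolP (g * tau m b \in C)) => // /(code_ball_disjoint codeC Ca) /esym.
Qed.

(** Double counting of the pairs [(g, a)] with [g * tau m a] a codeword: each [a] contributes [#|C|]
    because right multiplication is a bijection, and each covered [g] contributes exactly 1. *)
Lemma card_uncovered m (C : {set 'S_m.+1}) :
  kendall_code C 3 -> (#|uncovered C| + m.+1 * #|C|)%N = m.+1`!.
Proof.
move=> codeC; rewrite -card_Sn -(cardC (uncovered C)); congr (_ + _).
transitivity (\sum_(a < m.+1) #|C|); first by rewrite sum_nat_const card_ord.
rewrite -[RHS]sum1_card [RHS]big_mkcond /=.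
under [RHS]eq_bigr => g _.
  rewrite inE (_ : (if _ then _ else _) = nat_of_bool (g \notin uncovered C)); last by case: ifP.
  rewrite -sum_ball //; over.
rewrite exchange_big; apply: eq_bigr => a _.
rewrite (reindex_inj (mulIg (tau m a))) /= -sum1_card big_mkcond /=.
by apply: eq_bigr => g _; rewrite tauK; case: (g \in C).
Qed.

(** * The prime case *)

Local Close Scope group_scope.
Local Open Scope ring_scope.

(** Discharging between the positive part [p] and the negative part [q] of [u]. Where [u v > 0], the
    moved neighbours of [v] carry negative mass at least [(N - 5) * p v]; each [q v] is charged at
    most 4 times. So [(N - 5)] times the sum of [p] is at most 4 times the sum of [q], and
    [N - 5 >= 4]. *)
Lemma sum_le0_of_balls (V : finType) (N : nat) (f : 'I_N -> V -> V) (u : V -> int) :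
    (9 <= N)%N -> (forall a, involutive (f a)) ->
    (forall v, #|[set a | f a v != v]| <= 4)%N ->
    (forall v, \sum_a u (f a v) <= 1) ->
  \sum_v u v <= 0.
Proof.
move=> N9 fK moved4 ball1.
pose p v : int := Num.max (u v) 0; pose q v : int := Num.max (- u v) 0.
have q_ge0 v : 0 <= q v by rewrite le_max lexx orbT.
(* Integrality enters here: [U >= 1] absorbs the right-hand 1 and turns [N - 4] into [N - 5]. The
   sign of the product [(4 - d) * U] is a premise so that the rest is linear in the products. *)
have linear (A Q U : int) (d : nat) : 0 < U -> 0 <= (4 - d%:Z) * U -> - Q <= A ->
    A + (N%:Z - d%:Z) * U <= 1 -> (N%:Z - 5) * U <= Q by lia.
have linear4 (A B : int) : (N%:Z - 5) * A <= 4 * B -> 0 <= (N%:Z - 9) * A -> A - B <= 0 by lia.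
have local v : (N%:Z - 5) * p v <= \sum_(a | f a v != v) q (f a v).
  have [u_le0|u_gt0] := leP (u v) 0; first by rewrite /p max_r // mulr0 sumr_ge0.
  rewrite /p max_l; last exact: ltW.
  move: (ball1 v) (moved4 v).
  rewrite (bigID (fun a => f a v != v)) /=; set Mv := [set a | _] => + Mv4.
  have -> : \sum_(a | ~~ (f a v != v)) u (f a v) = (N%:Z - #|Mv|%:Z) * u v.
    rewrite (eq_bigr (fun _ => u v)) => [|a]; last by rewrite negbK => /eqP->.
    rewrite sumr_const -mulr_natl; congr (_ * _).
    have <- : #|~: Mv| = #|[pred a | ~~ (f a v != v)]| by apply: eq_card => a; rewrite !inE.
    by have := cardsC Mv; rewrite card_ord natz; lia.
  have : - \sum_(a | f a v != v) q (f a v) <= \sum_(a | f a v != v) u (f a v).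
    by rewrite -sumrN ler_sum // => a _; rewrite lerNl le_max lexx.
  have : 0 <= (4 - #|Mv|%:Z) * u v by apply: mulr_ge0; [rewrite subr_ge0 lez_nat | exact: ltW].
  exact: linear.
(* Since [f a] is an involution, the charge that [v] receives along [a] comes from [f a v], which
   differs from [v] exactly when [a] moves [v]; this happens for at most 4 values of [a]. *)
have swap : \sum_v \sum_(a | f a v != v) q (f a v) <= \sum_v 4 * q v.
  have -> : \sum_v \sum_(a | f a v != v) q (f a v) = \sum_v \sum_(a | f a v != v) q v.
    rewrite (exchange_big_dep predT) //= [RHS](exchange_big_dep predT) //=.
    apply: eq_bigr => a _.
    rewrite (reindex_inj (can_inj (fK a))) /=.
    by apply: eq_big => v; rewrite fK // eq_sym.
  apply: ler_sum => v _; rewrite sumr_const -[q v *+ _]mulr_natl.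
  by rewrite ler_wpM2r // ler_nat; move: (moved4 v); rewrite cardsE.
have sum_local : \sum_v (N%:Z - 5) * p v <= \sum_v 4 * q v.
  by apply: le_trans swap; apply: ler_sum.
rewrite -!mulr_sumr in sum_local.
have -> : \sum_v u v = \sum_v p v - \sum_v q v.
  by rewrite -sumrB; apply: eq_bigr => v _; rewrite /p /q; lia.
have p_ge0 : 0 <= \sum_v p v by apply: sumr_ge0 => v _; rewrite le_max lexx orbT.
have : 0 <= (N%:Z - 9) * \sum_v p v by rewrite mulr_ge0 // subr_ge0 lez_nat.
exact: linear4 sum_local.
Qed.

(** The fibre is the coset [H * s], where [H] fixes [k] and [l] pointwise and [s] sends [k] to [i]
    and [l] to [j]. *)
Lemma card_pair_fiber m (k l i j : 'I_m.+1) : k != l -> i != j ->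
  #|[set g : 'S_m.+1 | (g k, g l) == (i, j)]| = (m.-1)`!.
Proof.
move=> neq_kl neq_ij; pose s := (tperm k i * tperm (tperm k i l) j)%g.
(* Hence the second transposition in [s] fixes [i], the image of [k] under the first. *)
have neq_i : tperm k i l != i by rewrite -{2}(tpermL k i) (inj_eq perm_inj) eq_sym.
have sk : s k = i by rewrite permM tpermL tpermD // eq_sym.
have sl : s l = j by rewrite permM tpermL.
clearbody s.
have <- : #|perm_on (~: [set k; l])| = (m.-1)`!.
  rewrite card_perm; congr _`!.
  by have := cardsC [set k; l]; rewrite cards2 card_ord neq_kl; lia.
rewrite -sum1_card (reindex_inj (mulIg s)) /= -sum1_card; apply: eq_bigl => h.
rewrite inE xpair_eqE !permM -{1}sk -{1}sl !(inj_eq perm_inj).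
apply/andP/subsetP => [[/eqP hk /eqP hl] x|fix_h].
  by rewrite !inE; apply: contraNN => /orP[/eqP->|/eqP->]; rewrite ?hk ?hl.
by split; apply: contraT => /fix_h; rewrite !inE eqxx ?orbT.
Qed.

(** With [n = m.+1], the sum of [u] is [#|C| - a * (n * m)], and [a * n = (m.-1)! - 1] makes the
    subtracted term equal to [m! - m]. *)
Lemma card_code_prime m (C : {set 'S_m.+1}) :
  prime m.+1 -> (8 <= m)%N -> kendall_code C 3 -> (#|C| <= m`! - m)%N.
Proof.
move=> pr_n m8 codeC; pose k : 'I_m.+1 := ord0; pose l : 'I_m.+1 := ord_max.
have neq_kl : k != l by rewrite -val_eqE /=; lia.
have fact_m : (m`! = m * (m.-1)`!)%N by case: {codeC k l neq_kl C pr_n} m m8.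
(* Wilson gives [m * F + 1 = b * m.+1] for [F = (m.-1)!], which rearranges to
   [F - 1 = (F - b) * m.+1]. *)
have [a def_a] : exists a, ((m.-1)`! = a * m.+1 + 1)%N.
  have := pr_n; rewrite Wilson ?prime_gt1 //= fact_m => /dvdnP[b def_b].
  have := fact_gt0 m.-1; move: (m.-1)`! def_b => F def_b F_gt0.
  have le_bF : (b <= F)%N by nia.
  by exists (F - b)%N; rewrite -(subnK le_bF) in def_b *; nia.
pose x v := #|[set c in C | (c k, c l) == v]|.
(* Diagonal pairs are kept so that [f b] acts on the whole product; [x] vanishes there, so nothing
   is subtracted. *)
pose u (v : 'I_m.+1 * 'I_m.+1) : int := (x v)%:Z - (a * (v.1 != v.2))%N%:Z.
pose f (b : 'I_m.+1) (v : 'I_m.+1 * 'I_m.+1) := (tau m b v.1, tau m b v.2).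
have tauKp (b : nat) : involutive (tau m b) by move=> i; rewrite -permM -{1}tauV mulVg perm1.
have fK b : involutive (f b) by case=> i j; rewrite /f /= !tauKp.
have f_diag b v : ((f b v).1 == (f b v).2) = (v.1 == v.2) by rewrite (inj_eq perm_inj).
have xE b v : x (f b v) = (\sum_(g : 'S_m.+1 | (g k, g l) == v) (g * tau m b \in C)%g)%N.
  rewrite /x -sum1_card (reindex_inj (mulIg (tau m b))) /= big_mkcond [RHS]big_mkcond /=.
  apply: eq_bigr => g _; case: v => i j.
  rewrite inE !xpair_eqE !permM !(inj_eq perm_inj) /=.
  by case: (_ \in C) => /=; case: (_ && _).
(* The sum of [x] over the ball counts the covered [g] with [(g k, g l) = v]: none on the diagonal,
   at most [(m.-1)! = a * m.+1 + 1] off it. *)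
have ball1 v : \sum_b u (f b v) <= 1.
  rewrite sumrB -!(big_morph Posz PoszD (erefl _)).
  under [X in _ - X%:Z]eq_bigr do rewrite f_diag.
  under eq_bigr do rewrite xE.
  rewrite exchange_big sum_nat_const card_ord /=.
  under eq_bigr do rewrite sum_ball //.
  case: eqP => [eq_v|/eqP neq_v].
    rewrite big_pred0 ?muln0 // => g; apply/eqP => eq_gv; move: eq_v.
    by rewrite -eq_gv /= => /perm_inj /eqP; rewrite (negPf neq_kl).
  have : (\sum_(g : 'S_m.+1 | (g k, g l) == v) (g \notin uncovered C) <= (m.-1)`!)%N.
    rewrite -(card_pair_fiber neq_kl neq_v) -surjective_pairing -sum1dep_card.
    by apply: leq_sum => g _; apply: leq_b1.
  rewrite def_a /= muln1 => le_s; rewrite lerBlDr -[1]/1%:Z -PoszD lez_nat.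
  by apply: leq_trans le_s _; rewrite addnC mulnC.
(* [tau m b] moves only the points [b] and [b.+1], so each of the two coordinates is moved by at
   most two values of [b]. *)
have moved4 v : (#|[set b : 'I_m.+1 | f b v != v]| <= 4)%N.
  pose near (i : 'I_m.+1) := [set i; inord i.-1].
  have fix_tau (b i : 'I_m.+1) : b \notin near i -> tau m b i = i.
    rewrite !inE negb_or -!val_eqE /= inordK; last by have := ltn_ord i; lia.
    case: (leqP m b) => [mb|bm] neq_bi.
      by rewrite (eqP (_ : tau m b == 1%g)) ?perm1 // tau_eq1.
    by apply: val_inj; rewrite /= val_tau //; do 2?case: eqP; lia.
  have card_near i : (#|near i| <= 2)%N by rewrite cards2; case: (_ != _).
  apply: (@leq_trans #|near v.1 :|: near v.2|).
    apply: subset_leq_card; apply/subsetP => b; rewrite inE; apply: contraNT.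
    by rewrite inE negb_or => /andP[b1 b2]; rewrite /f !fix_tau // -surjective_pairing.
  by have := cardsU (near v.1) (near v.2); have := card_near v.1; have := card_near v.2; lia.
(* [m8] serves as [9 <= m.+1] by conversion. *)
have := sum_le0_of_balls (N := m.+1) m8 fK moved4 ball1.
rewrite sumrB -!(big_morph Posz PoszD (erefl _)) -big_distrr /=.
have -> : (\sum_v x v = #|C|)%N.
  rewrite -[RHS]sum1_card (partition_big (fun c : 'S_m.+1 => (c k, c l)) predT) //=.
  by apply: eq_bigr => v _; rewrite sum1dep_card.
have -> : (\sum_(v : 'I_m.+1 * 'I_m.+1) (v.1 != v.2) = m.+1 * m)%N.
  rewrite -(pair_bigA _ (fun i j : 'I_m.+1 => (i != j) : nat)) /=.
  transitivity (\sum_(i < m.+1) m)%N; last by rewrite sum_nat_const card_ord.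
  apply: eq_bigr => i _.
  transitivity #|predC1 i|; last by rewrite cardC1 card_ord.
  by rewrite -sum1_card [RHS]big_mkcond /=; apply: eq_bigr => j _; rewrite inE eq_sym; case: eqP.
rewrite subr_le0 lez_nat fact_m def_a mulnDr muln1 addnK => /leq_trans; apply.
by rewrite [leqRHS]mulnCA (mulnC m.+1).
Qed.

Local Close Scope ring_scope.
Local Open Scope group_scope.

(** * Words and sets of words *)

Fixpoint swap_at (a : nat) (w : seq nat) : seq nat :=
  match a, w with
  | 0, x :: y :: v => y :: x :: v
  | b.+1, x :: v => x :: swap_at b v
  | _, _ => w
  end.

(* One-line notation of the inverse, so that multiplying by [tau m a] on the right exchanges the
   letters at positions [a] and [a.+1]. *)
Definition word_of m (s : 'S_m.+1) : seq nat := [seq val (s^-1 i) | i <- enum 'I_m.+1].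

Lemma size_word_of m (s : 'S_m.+1) : size (word_of s) = m.+1.
Proof. by rewrite size_map size_enum_ord. Qed.

Lemma nth_word_of m (s : 'S_m.+1) (i : 'I_m.+1) : nth 0 (word_of s) i = s^-1 i.
Proof. by rewrite (nth_map i) ?size_enum_ord // nth_ord_enum. Qed.

Lemma word_of_inj m : injective (@word_of m).
Proof.
move=> s t eq_st; apply: invg_inj; apply/permP => i; apply: val_inj => /=.
by rewrite -!nth_word_of eq_st.
Qed.

Lemma size_swap_at a w : size (swap_at a w) = size w.
Proof. by elim: a w => [|a IHa] [|x [|y w]] //=; rewrite IHa. Qed.

Lemma swap_at_id a w : size w <= a.+1 -> swap_at a w = w.
Proof.
elim: a w => [|a IHa] [|x w] //=; first by case: w.
by rewrite ltnS => /IHa ->.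
Qed.

Lemma nth_swap_at a w i : a.+1 < size w ->
  nth 0 (swap_at a w) i = nth 0 w (if i == a then a.+1 else if i == a.+1 then a else i).
Proof.
elim: a w i => [|a IHa] [|x w] i //=; first by case: w => [|y w] // _; case: i => [|[|i]].
rewrite ltnS => /IHa {}IHa; case: i => [|i] //=; rewrite IHa (eqSS i a) (eqSS i a.+1).
by case: ifP => // _; case: ifP.
Qed.

(** This holds for every [a]: from [a = m] on, [swap_at] has no pair to exchange and leaves the word
    unchanged, while [tau m a] is the identity. *)
Lemma word_of_tau m (s : 'S_m.+1) a : word_of (s * tau m a) = swap_at a (word_of s).
Proof.
apply: (@eq_from_nth _ 0) => [|i]; first by rewrite size_swap_at !size_word_of.
rewrite size_word_of => lt_i; rewrite (nth_word_of _ (Ordinal lt_i)) invMg tauV permM.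
rewrite -nth_word_of; have [ma|am] := leqP m a.
  by rewrite swap_at_id ?size_word_of // (eqP (_ : tau m a == 1)) ?tau_eq1 ?perm1.
by rewrite nth_swap_at ?size_word_of // val_tau.
Qed.

Lemma word_of1 m : word_of (1 : 'S_m.+1) = iota 0 m.+1.
Proof.
apply: (@eq_from_nth _ 0) => [|i]; first by rewrite size_word_of size_iota.
rewrite size_word_of => lt_i.
by rewrite (nth_word_of _ (Ordinal lt_i)) invg1 perm1 nth_iota.
Qed.

Definition path_perm m (p : seq nat) : 'S_m.+1 := foldl (fun s a => s * tau m a) 1 p.

Lemma word_of_path_perm m p :
  word_of (path_perm m p) = foldl (fun w a => swap_at a w) (iota 0 m.+1) p.
Proof.
rewrite /path_perm -word_of1; elim: p 1 => //= a p IHp s.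
by rewrite IHp word_of_tau.
Qed.

(** Prefix tree in which letter [x] selects child [x] and a missing child stands for the empty set;
    the length of a lookup does not grow with the number of stored words. *)
Inductive trie := Trie of bool & seq trie.

Definition trie0 := Trie false [::].

Fixpoint tmem (w : seq nat) (t : trie) : bool :=
  let: Trie b l := t in
  if w is x :: v then tmem v (nth trie0 l x) else b.

Fixpoint tadd (w : seq nat) (t : trie) : trie :=
  let: Trie b l := t in
  if w is x :: v then Trie b (set_nth trie0 l x (tadd v (nth trie0 l x)))
  else Trie true l.

Lemma tmem_trie0 w : tmem w trie0 = false.
Proof. by elim: w => //= x w; rewrite nth_nil. Qed.

Lemma tmem_tadd v w t : tmem v (tadd w t) = (v == w) || tmem v t.
Proof.
elim: w v t => [|x w IHw] [|y v] [b l] //=.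
rewrite nth_set_nth /= eqseq_cons; case: eqP => [->|] //=.
Qed.

(** * Certified branching *)

(* An element of [W] is given by the positions successively swapped, starting from the identity. *)
Definition item (n : nat) (W : seq (seq nat)) (i : nat) : seq nat :=
  foldl (fun w a => swap_at a w) (iota 0 n) (nth [::] W i).

(* Up to commutation these pairs reach every word at distance 1 or 2, the pair [(a, n.-1)]
   standing for a single swap. *)
Definition near_pairs (n : nat) : seq (nat * nat) :=
  [seq (a, b) | a <- iota 0 n, b <- [seq b <- iota 0 n | (b < a) || (b == a.+1)]].

Definition kill_near (ps : seq (nat * nat)) (w : seq nat) (t : trie) : trie :=
  foldr (fun p t => tadd (swap_at p.2 (swap_at p.1 w)) t) t ps.

Definition kill_ball (n : nat) (w : seq nat) (t : trie) : trie :=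
  foldr (fun a t => tadd (swap_at a w) t) t (iota 0 n).

(* Branching proof that at least [k] items of [W] outside [sk] are uncovered. The stream [c] of
   item indices dictates the branching: either item [i] is uncovered, or one of the [n] words [x]
   of its unit ball is a codeword, which excludes those obtained from [x] by two further swaps.
   Words known not to be codewords are collected in [dead]; [sk] lists the items already assumed
   uncovered. The value returned is the unread part of the stream. *)
Fixpoint refute (n : nat) (ps : seq (nat * nat)) (W : seq (seq nat)) (fuel k : nat)
    (sk : seq nat) (dead : trie) (c : seq nat) : option (seq nat) :=
  if k is k'.+1 then
    if fuel is f.+1 then
      if c is i :: c1 then
        if (i < size W) && (i \notin sk) then
          let w := item n W i in
          let branch oc a :=
            if oc is Some c2 then
              let x := swap_at a w in
              if tmem x dead then Some c2
              else refute n ps W f k sk (kill_near ps x dead) c2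
            else None in
          if foldl branch (Some c1) (iota 0 n) is Some c3
          then refute n ps W f k' (i :: sk) (kill_ball n w dead) c3
          else None
        else None
      else None
    else None
  else Some c.

Lemma foldl_obind (S A : Type) (F : A -> S -> option S) (s : seq A) (o : option S) c :
  foldl (fun oc a => if oc is Some c then F a c else None) o s = Some c ->
  exists c0, o = Some c0.
Proof.
elim: s o => [|a s IHs] o /=; first by exists c.
by case/IHs => c0; case: o => // c1 _; exists c1.
Qed.

(** The branches at a node consume one common stream in turn, so success of the whole fold means
    that each branch succeeded on some part of it. *)
Lemma foldl_obind_mem (S : Type) (A : eqType) (F : A -> S -> option S) (s : seq A) o c a :
  foldl (fun oc a => if oc is Some c then F a c else None) o s = Some c ->
  a \in s -> exists c1 c2, F a c1 = Some c2.
Proof.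
elim: s o => //= b s IHs o eq_c; rewrite inE => /orP[/eqP->|]; last exact: IHs eq_c.
by have [c2] := foldl_obind eq_c; case: o {eq_c} => // c1 Fc1; exists c1, c2.
Qed.

Lemma tmem_foldr (A : Type) (f : A -> seq nat) (s : seq A) v t :
  tmem v (foldr (fun a t => tadd (f a) t) t s) = has (fun a => v == f a) s || tmem v t.
Proof. by elim: s => //= a s IHs; rewrite tmem_tadd IHs orbA. Qed.

(** Settles the leaves of the branching. The count is by index, so repeated entries of [W] would do
    no harm. *)
Lemma size_le_count (T : Type) (x0 : T) (P : pred T) (W : seq T) (sk : seq nat) :
  uniq sk -> (forall i, i \in sk -> i < size W /\ P (nth x0 W i)) -> size sk <= count P W.
Proof.
move=> uniq_sk sk_P; rewrite -[W in count _ W](mkseq_nth x0) count_map -size_filter.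
apply: uniq_leq_size => // i /sk_P[ltiW Pi].
by rewrite mem_filter /= Pi mem_iota.
Qed.

(** The invariant is relative to a translate by [g]: words in [dead] give non-codewords [g * h], and
    [sk] lists distinct items whose translates are uncovered. An uncovered item moves one unit from
    [k] to [sk]; a covered one leads into the branch of its covering codeword. *)
Lemma refute_sound n m (C : {set 'S_m.+1}) (g : 'S_m.+1) ps W fuel k sk dead c c' :
    kendall_code C 3 ->
    all (fun p => [&& p.1 < n, p.2 < n & p.1 != p.2]) ps -> n = m.+1 ->
    refute n ps W fuel k sk dead c = Some c' ->
    (forall h : 'S_m.+1, tmem (word_of h) dead -> g * h \notin C) ->
    uniq sk ->
    (forall i, i \in sk ->
       i < size W /\ g * path_perm m (nth [::] W i) \in uncovered C) ->
  (k + size sk <= count (fun p => (g * path_perm m p)%g \in uncovered C) W)%N.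
Proof.
move=> codeC ps_ok def_n.
elim: fuel k sk dead c c' => [|f IHf] [|k] sk dead c c' //=.
- by move=> _ _; exact: size_le_count.
- by move=> _ _; exact: size_le_count.
case: c => // i c1; case: ifP => // /andP[ltiW sk'i].
case eq_c3: (foldl _ _ _) => [c3|//] ref_sk deadP uniq_sk skP.
(* Up to here [n] is a variable, so simplification cannot unfold [iota 0 n]. *)
subst n; set h := path_perm m (nth [::] W i).
have word_h a : swap_at a (item m.+1 W i) = word_of (h * tau m a).
  by rewrite word_of_tau word_of_path_perm.
have [Ui|] := boolP (g * h \in uncovered C).
  rewrite addSnnS; apply: (IHf _ (i :: sk) _ _ _ ref_sk) => /=.
  - move=> h'; rewrite /kill_ball tmem_foldr => /orP[/hasP[a]|]; last exact: deadP.
    rewrite mem_iota /= add0n => lta; rewrite word_h => /eqP /word_of_inj ->.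
    by move: Ui; rewrite inE => /forallP /(_ (Ordinal lta)); rewrite mulgA.
  - by rewrite sk'i.
  - by move=> j; rewrite inE => /predU1P[->|/skP].
rewrite inE => /forallPn[a]; rewrite negbK -mulgA => Ca.
have [|c1' [c2']] := foldl_obind_mem eq_c3 (_ : val a \in iota 0 m.+1).
  by rewrite mem_iota /= add0n.
(* A branch skipped by [refute] is contradictory: its word is dead, yet it would be a codeword. *)
rewrite word_h; case: ifP => [/deadP|_ ref_a]; first by rewrite Ca.
apply: (IHf _ _ _ _ _ ref_a) => // h'.
rewrite /kill_near tmem_foldr => /orP[/hasP[[b d] /(allP ps_ok) /= /and3P[ltb ltd neq_bd]]|].
  rewrite -!word_of_tau => /eqP /word_of_inj ->; apply: contraNN neq_bd => Cbd.
  (* With [x] the assumed codeword, the ball around [x * tau m b] contains [x] at index [b] and the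
     new word at index [d]; if both were codewords, [b] and [d] would coincide. *)
  apply/eqP; apply: (congr1 val (x := Ordinal ltb) (y := Ordinal ltd)).
  apply: (code_ball_disjoint (g := g * (h * tau m a) * tau m b) codeC) => /=.
    by rewrite tauK.
  by rewrite !mulgA in Cbd *.
exact: deadP.
Qed.

Lemma near_pairsP n : all (fun p => [&& p.1 < n, p.2 < n & p.1 != p.2]) (near_pairs n).
Proof.
apply/allP => p /allpairsPdep[a [b []]]; rewrite mem_filter !mem_iota /=.
by move=> ltan /andP[near_ab ltbn] ->; rewrite /=; lia.
Qed.

(** For a fixed item, its translates by all [g] run through the group once, so the numbers of
    uncovered items over all translates add up to [size W * #|uncovered C|]. *)
Lemma sample_bound m (C : {set 'S_m.+1}) W fuel k c c' :
    kendall_code C 3 ->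
    refute m.+1 (near_pairs m.+1) W fuel k [::] trie0 c = Some c' ->
  (k * m.+1`! <= size W * (m.+1`! - m.+1 * #|C|))%N.
Proof.
move=> codeC ref_W; rewrite -(card_uncovered codeC) addnK (card_uncovered codeC).
have -> : (size W * #|uncovered C| =
    \sum_(g : 'S_m.+1) count (fun p => (g * path_perm m p)%g \in uncovered C) W)%N.
  under eq_bigr do rewrite -sum1_count big_mkcond /=.
  rewrite exchange_big /= -sum1_size big_distrl /=; apply: eq_bigr => p _.
  rewrite mul1n [RHS](reindex_inj (mulIg (path_perm m p)^-1)) /= -sum1_card big_mkcond.
  by apply: eq_bigr => g _; rewrite mulgKV.
rewrite -card_Sn mulnC -sum_nat_const; apply: leq_sum => g _.
have := refute_sound (g := g) codeC (near_pairsP _) erefl ref_W; rewrite addn0; apply => // h.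
by rewrite tmem_trie0.
Qed.

Local Close Scope group_scope.

(* The samples and branchings come from a computer search: local search for the sets, then at each
   node the item with the smallest subtree among those with the fewest possible covers. *)
Definition sample6 : seq (seq nat) := [::
  [:: 4; 0]; [::]; [:: 0; 1]; [:: 3; 4; 3; 1]; [:: 0]; [:: 3; 0; 1; 0]; [:: 3]; [:: 4; 1];
  [:: 3; 4; 0; 1]; [:: 3; 0]; [:: 4; 3; 0]; [:: 4]; [:: 3; 4; 3; 1; 0]; [:: 4; 3; 1; 0];
  [:: 3; 0; 1]; [:: 3; 4; 1]; [:: 1; 0]; [:: 0; 1; 0]; [:: 3; 4]; [:: 4; 3; 1]; [:: 4; 0; 1];
  [:: 4; 3]; [:: 1]; [:: 3; 1; 0]; [:: 3; 4; 3]; [:: 3; 4; 3; 0; 1; 0]; [:: 3; 4; 0]; [:: 2];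
  [:: 4; 1; 0]; [:: 4; 3; 0; 1]; [:: 4; 0; 1; 0]; [:: 2; 0]; [:: 3; 2]; [:: 0; 1; 2; 0];
  [:: 0; 1; 2]; [:: 2; 1]; [:: 1; 2; 0]; [:: 4; 2]; [:: 1; 2]; [:: 3; 1; 2]; [:: 3; 4; 3; 0];
  [:: 4; 2; 0]; [:: 3; 2; 0]; [:: 4; 3; 0; 1; 0]; [:: 3; 4; 2]; [:: 4; 1; 2]; [:: 3; 4; 1; 0];
  [:: 2; 0; 1]; [:: 4; 3; 2]; [:: 2; 3; 2]; [:: 3; 2; 0; 1]; [:: 3; 4; 3; 2]; [:: 2; 3];
  [:: 4; 3; 2; 0]; [:: 2; 3; 0]; [:: 4; 1; 2; 0]; [:: 3; 2; 1]; [:: 0; 1; 2; 1]; [:: 3; 1; 2; 0];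
  [:: 4; 2; 3; 0]; [:: 4; 2; 3]; [:: 2; 3; 4; 2]; [:: 2; 1; 0]; [:: 1; 2; 0; 1]; [:: 3; 4; 1; 2];
  [:: 3; 4; 2; 3]; [:: 4; 2; 3; 2]; [:: 2; 3; 1]; [:: 4; 1; 2; 1]; [:: 3; 1; 2; 1];
  [:: 4; 0; 1; 2; 0]; [:: 1; 2; 1]; [:: 1; 2; 3; 1]; [:: 3; 0; 1; 2]; [:: 4; 3; 2; 1];
  [:: 3; 2; 0; 1; 0]; [:: 3; 1]; [:: 2; 3; 1; 0]].

Definition branching6 : seq nat := [::
  76; 22; 14; 9; 18; 8; 26; 8; 26; 10; 17; 2; 30; 2; 30; 42; 32; 50; 21; 24; 21; 24; 21; 24; 42;
  32; 50; 8; 18; 26; 2; 17; 25; 9; 73; 31; 29; 73; 29; 31; 42; 9; 73; 20; 41; 9; 31; 18; 7; 25; 15;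
  10; 54; 49; 61; 44; 31; 25; 7; 10; 17; 36; 63; 35; 43; 10; 9; 31; 54; 9; 31; 18; 7; 25; 15; 10;
  54; 49; 61; 44; 17; 20; 25; 9; 18; 29; 9; 18; 26; 10; 2; 17; 21; 24; 7; 27; 3; 19; 2; 17; 20; 17;
  20; 12; 13; 9; 6; 18; 28; 6; 39; 25; 29; 25; 29; 6; 39; 6; 18; 2; 17; 12; 13; 31; 35; 41; 2; 6;
  10; 4; 6; 39; 3; 64; 18; 2; 17; 10; 51; 3; 39; 66; 41; 59; 4; 10; 41; 31; 59; 6; 9; 18; 2; 31;
  17; 10; 41; 59; 1; 6; 18; 11; 14; 8; 26; 25; 29; 11; 39; 32; 14; 42; 8; 12; 10; 35; 28; 34; 54;
  67; 72; 68; 35; 68; 28; 72; 67; 12; 10; 54; 55; 33; 34; 14; 8; 12; 10; 35; 52; 67; 72; 68; 28;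
  62; 34; 14; 8; 12; 10; 42; 32; 50; 75; 27; 39; 32; 11; 18; 14; 8; 26; 25; 29; 11; 28; 2; 17; 0;
  28; 28; 11; 0; 28; 13; 12; 11; 1; 6; 18; 17; 11; 1; 30; 11; 1; 1; 17; 20; 30; 12; 13; 36; 38; 37;
  27; 6; 21; 3; 6; 15; 27; 37; 52; 12; 13; 38; 36; 71; 55; 13; 0; 0; 4; 8; 15; 10; 41; 54; 59; 3;
  13; 0; 4; 8; 15; 10; 41; 54; 59; 3; 13; 3; 15; 6; 8; 17; 2; 10; 41; 31; 32; 50; 9; 12; 13; 11; 2;
  17; 1; 6; 18; 7; 19; 25; 29; 12; 13; 42; 14; 32; 39; 14; 50; 75; 7; 3; 12; 13; 2; 17; 13; 3; 10;
  55; 36; 38; 39; 6; 31; 27; 10; 41; 31; 59; 6; 9; 4; 16; 22; 23; 15; 3; 8; 5; 12; 13; 5; 58; 3; 8;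
  13; 3; 13; 8; 33; 0; 21; 10; 57; 47; 27; 52; 60; 15; 58; 5; 3; 12; 7; 28; 22; 11; 31; 62; 35; 0;
  52; 59; 0; 26; 54; 59; 47; 35; 3; 19; 23; 0; 48; 66; 51; 3; 19; 23; 0; 48; 66; 51; 3; 19; 23; 0;
  48; 66; 51; 23; 15; 3; 12; 46; 39; 3; 64; 27; 0; 47; 35; 27; 0; 47; 35; 3; 27; 0; 47; 35; 3; 12;
  8; 5; 27; 31; 62; 35; 47; 35; 70; 33; 5; 23; 36; 43; 23; 15; 22; 7; 28; 23; 15; 3; 5; 8; 13; 11;
  3; 0; 15; 23; 8; 34; 33; 57; 16; 21; 10; 37; 52; 60; 21; 10; 37; 52; 60; 34; 33; 57; 16; 5; 58;
  21; 10; 8; 5; 34; 33; 57; 20; 2; 23; 15; 38; 37; 52; 36; 71; 8; 14; 15; 24; 44; 30; 2; 23; 15;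
  30; 2; 23; 15; 30; 13; 0; 2; 20; 12; 23; 15; 14; 8; 0; 15; 14; 8; 0; 23; 46; 22; 0; 7; 15; 34;
  57; 33; 14; 63; 5; 58; 14; 33; 70; 43; 3; 43; 70; 33; 5; 13; 34; 33; 57; 15; 34; 33; 57; 2; 20;
  7; 0; 2; 20; 0; 16; 0; 7; 16; 22; 2; 0; 20; 34; 33; 57; 0; 16; 7; 2; 20; 31; 2; 22; 7; 28; 27;
  62; 35; 27; 62; 35; 34; 14; 23; 15; 46; 22; 34; 14; 5; 40; 21; 24; 27; 62; 35; 27; 22; 2; 47; 37;
  21; 30; 47; 37; 21; 55; 30; 45; 47; 2; 37; 21; 24; 53; 74; 22; 2; 47; 30; 7; 35; 7; 2; 47; 17;
  35; 21; 60; 67; 49; 28; 37; 27; 60; 21; 24; 21; 24; 53; 74; 7; 20; 2; 11; 0; 22; 2; 20; 30; 5; 8;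
  33; 70; 43; 13; 3; 10; 21; 22; 11; 15; 0; 45; 55; 70; 43; 46; 16; 28; 3; 15; 23; 2; 30; 16; 8;
  33; 34; 31; 27; 41; 37; 13; 2; 20; 23; 16; 46; 15; 22; 21; 2; 20; 30; 4; 1; 40; 8; 10; 30; 2; 32;
  27; 37; 4; 1; 8; 32; 56; 50; 28; 28; 6; 18; 4; 1; 15; 22; 3; 12; 28; 46; 12; 18; 25; 2; 21; 43;
  0; 4; 32; 73; 42; 26; 3; 15; 46; 28; 21; 4; 1; 15; 40; 7; 22; 15; 32; 2; 30; 46; 3; 12; 14; 5;
  12; 3; 1; 38; 4; 11; 1; 11; 1; 14; 5; 12; 3; 1; 38; 56; 42; 38; 45; 55; 19; 1; 30; 1; 21; 10; 40;
  42; 14; 1; 45; 38; 19; 38; 45; 55; 19; 1; 30; 21; 4; 11; 40; 46; 46; 30; 10; 21; 40; 11; 1; 6; 2;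
  55; 11; 1; 13; 18; 26; 18; 26; 18; 7; 6; 2; 31; 27; 38; 6; 11; 1; 6; 18; 5; 8; 2; 20; 18; 5; 14;
  46; 12; 13; 18; 6; 11; 1; 6; 8; 5; 18; 5; 14; 1; 5; 14; 6; 18; 8; 6; 18; 26; 0; 25; 43; 4; 8; 5;
  4; 8; 5; 3; 11; 13; 25; 43; 19; 25; 11; 43; 43; 25; 6; 9; 18; 9; 18; 29; 7; 22; 16; 22; 16; 25;
  6; 9; 29; 11; 38; 4; 6; 9; 10; 21; 2; 17; 3; 22; 7; 43; 25; 18; 51; 3; 19; 22; 13; 16; 22; 16;
  28; 7; 38; 36; 17; 45; 19; 45; 19; 63; 17; 63; 17; 45; 19; 17; 2; 25; 36; 63; 19; 3; 0; 32; 35;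
  16; 28; 13; 19; 28; 13; 19; 18; 25; 32; 42; 14; 56; 24; 65; 14; 5; 0; 50; 56; 24; 65; 14; 5; 0;
  24; 10; 34; 53; 44; 38; 52; 65; 32; 14; 42; 24; 9; 25; 29; 0; 53; 51; 48; 43; 16; 33; 34; 54; 56;
  50; 61; 49; 0; 53; 29; 8; 14; 26; 9; 40; 26; 24; 25; 43; 29; 10; 40; 19; 28; 13; 13; 16; 3; 6; 8;
  5; 25; 0; 11; 32; 27; 38; 26; 24; 6; 18; 19; 13; 10; 22; 7; 43; 25; 18; 51; 22; 16; 28; 46; 12;
  18; 26; 22; 16; 11; 1; 15; 3; 22; 16; 16; 7; 22; 15; 32; 8; 5; 14; 56; 42; 11; 21; 37; 27; 60; 2;
  31; 40; 2; 60; 31; 9; 6; 47; 67; 71; 40; 31; 2; 40; 27; 47; 2; 17; 6; 26; 9; 23; 15; 9; 27; 52;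
  47; 17; 37; 15; 19; 48; 53; 74; 23; 46; 30; 2; 17; 6; 18; 2; 31; 27; 47; 3; 12; 55; 68; 45; 36;
  71; 72; 35; 4; 0; 30; 45; 36; 23; 19; 45; 68; 35; 31; 62; 0; 21; 4; 10; 40; 10; 6; 9; 13; 19; 15;
  25; 43; 4; 23; 15; 25; 43; 4; 23; 4; 10; 40; 20; 30; 4; 2; 48; 66; 51; 9; 6; 19; 9; 6; 19; 6; 9;
  18; 9; 18; 9; 6; 31; 54; 59; 30; 4; 2; 31; 35; 62; 72; 68; 35; 47; 4; 2; 45; 68; 35; 31; 62; 18;
  15; 39; 6; 3; 64; 5; 58; 14; 6; 3; 27; 0; 52; 60; 6; 3; 13; 0; 4; 27; 52; 60; 6; 3; 13; 0; 4; 52;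
  27; 27; 60; 6; 23; 28; 4; 0; 70; 43; 34; 33; 57; 34; 33; 57; 2; 20; 2; 20; 70; 43; 4; 0; 34; 33;
  57; 5; 14; 29; 46; 0; 53; 23; 4; 0; 34; 33; 57; 23; 4; 6; 39; 0; 34; 33; 57; 6; 5; 14; 29; 46; 0;
  53; 6; 23; 15; 64; 3; 8; 5; 3; 64; 5; 8; 13; 5; 8; 2; 0; 13; 17; 55; 36; 58; 3; 8; 5; 12; 13; 9;
  26; 6; 23; 15; 3; 5; 8; 13; 9; 26; 21; 30; 20; 9; 6; 31; 23; 41; 54; 48; 66; 51; 23; 36; 55; 45;
  13; 15; 48; 19; 37; 3; 13; 10; 0; 4; 40; 6; 18; 6; 23; 15; 8; 5; 9; 26; 6; 1; 8; 32; 44; 49; 61;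
  50; 49; 54; 67; 5; 23; 0; 11; 36; 71; 5; 23; 0; 11; 36; 55; 13; 0; 32; 49; 44; 32; 49; 44; 10;
  13; 12; 19; 12; 19; 24; 41; 31; 59; 24; 44; 32; 31; 54; 41; 5; 8; 20; 7; 22; 2; 23; 7; 22; 36;
  55; 13; 9; 26; 4; 1; 22; 12; 19; 39; 69; 58; 39; 69; 58; 16; 25; 29; 28; 12; 19; 25; 29; 0; 1; 0;
  27; 22; 12; 19; 24; 40; 4; 1; 4; 1; 27; 37; 52; 41; 21; 22; 20; 39; 22; 20; 17; 26; 69; 58; 5;
  14; 10; 21; 24; 21; 24; 8; 26; 22; 39; 7; 12; 19; 39; 69; 58; 21; 24; 8; 14; 39; 17; 20; 26; 7;
  22; 69; 58; 26; 24; 40; 4; 1; 4; 1; 8; 39; 5; 14; 69; 58; 9; 23; 19; 17; 20; 30; 7; 16; 17; 36;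
  7; 16; 7; 28; 12; 20; 12; 13; 12; 13; 45; 36; 33; 20; 24; 10; 41; 37; 7; 36; 17; 16; 7; 17; 36;
  63; 38; 16; 31; 54; 41; 49; 61; 44; 41; 37; 7; 2; 24; 25; 29; 8; 14; 2; 20; 7; 16; 28; 12; 19; 8;
  14; 2; 20; 21; 10; 26; 21; 10; 26; 0; 7; 16; 24; 44; 49; 65; 7; 2; 19; 12; 17; 16; 23; 24; 25;
  29; 36; 21; 37; 41; 20; 24; 25; 29; 4; 1; 12; 19; 1; 8; 5; 20; 41; 37; 27; 47; 32; 39; 71; 0; 21;
  1; 4; 9; 26; 10; 40; 1; 20; 7; 22; 41; 37; 7; 22; 27; 39; 17; 32; 4; 0; 18; 14; 32; 50; 42; 44;
  61; 49; 24; 44; 4; 1; 42; 1; 4; 5; 34; 10; 24; 5; 42; 4; 1; 34; 50; 56; 69; 24; 21; 38; 1; 0; 11;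
  5; 32; 44; 61; 49; 10; 24; 41; 31; 59; 5; 24; 44; 32; 65; 29; 7; 16; 0; 11; 53; 24; 44; 32; 65;
  4; 1; 26; 40; 9; 16; 10; 7; 5; 28; 33; 24; 25; 43; 29; 3; 12; 10; 7; 5; 27; 37; 52; 56; 42; 24;
  4; 1; 9; 4; 11; 9; 17; 20; 5; 33; 16; 11; 1; 14; 8; 42; 48; 51; 56; 50; 56; 50; 3; 64; 3; 64; 56;
  50; 48; 51; 3; 64; 5; 48; 51; 7; 3; 12; 16; 4; 9; 3; 9; 17; 20; 30; 29; 48; 19; 51; 53; 4; 34;
  33; 16; 4; 34; 33; 16; 4; 34; 33; 16; 20; 30; 8; 5; 14; 51; 29; 12; 9; 25; 12; 19; 29; 9; 25; 1;
  27; 37; 52; 56; 42; 4; 9; 9; 24; 40; 4; 11; 4; 1; 14; 5; 42; 56; 50; 19; 7; 16; 25; 29; 1; 4; 9;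
  26; 44; 49; 65; 61; 49; 1; 4; 9; 26; 44; 49; 65; 61; 49; 30; 4; 11; 17; 11; 1; 11; 1; 29; 25; 9;
  26; 1; 17; 20; 12; 13; 17; 11; 1; 0; 1; 0; 36; 63; 38; 29; 48; 20; 53; 45; 38; 29; 48; 20; 53;
  45; 11; 1; 48; 53; 29; 7; 28; 11; 1; 48; 53; 74; 7; 45; 1; 16; 7; 17; 11; 1; 36; 63; 38; 16; 28;
  24; 48; 51; 44; 11; 1; 32; 14; 42; 66; 19; 3; 29; 25; 64; 11; 53; 29; 3; 12; 11; 7; 3; 12; 1; 16;
  40; 26; 9; 10; 11; 1; 1; 17; 20; 7; 16; 4; 0; 1; 6; 18; 26; 15; 46; 21; 11; 22; 45; 55; 30; 16;
  10; 40; 0; 4; 8; 11; 23; 15; 3; 12; 5; 11; 3; 23; 4; 15; 4; 8; 5; 13; 6; 9; 26; 22; 5; 14; 7; 39;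
  46; 46; 28; 9; 32; 40; 21; 30; 17; 39; 38; 22; 2; 14; 5; 30; 7; 3; 19; 28; 22; 2; 20; 30; 19; 4;
  3; 45; 38; 30; 63; 62; 35; 6; 18; 16; 28; 23; 46; 9; 16; 7; 28; 25; 29; 17; 63; 36; 38; 36; 18;
  26; 23; 15; 10; 42; 14; 2; 73; 0; 32; 50; 14; 2; 47; 44; 61; 67; 77; 21; 24].

Definition sample7 : seq (seq nat) := [::
  [:: 1]; [:: 5]; [:: 5; 4]; [:: 5; 0]; [:: 5; 1]; [:: 5; 0; 1]; [:: 0; 1]; [:: 5; 3]; [:: 4; 0];
  [:: 3; 0]; [:: 1; 0]; [:: 5; 3; 1; 0]; [:: 5; 1; 0]; [:: 5; 3; 0; 1]; [:: 4]; [:: 3]; [:: 5; 2];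
  [:: 4; 1]; [:: 0]; [:: 0; 1; 0]; [:: 5; 3; 0; 1; 0]; [:: 5; 4; 0]; [:: 4; 5]; [:: 5; 4; 2];
  [:: 5; 4; 1]; [:: 3; 0; 1]; [:: 5; 0; 1; 0]; [:: 3; 0; 1; 0]; [:: 3; 1]; [:: 3; 1; 0];
  [:: 5; 3; 0]; [:: 5; 3; 1]; [:: 4; 5; 4]; [:: 5; 3; 4]; [:: 4; 5; 2]; [:: 5; 2; 0]; [:: 4; 2];
  [:: 2; 0]; [:: 4; 5; 0]; [:: 4; 5; 2; 0]; [:: 4; 1; 0]; [:: 4; 0; 1]; [:: 3; 4; 1];
  [:: 5; 3; 4; 0]; [:: 4; 2; 0]; [:: 3; 4]; [:: 5; 3; 4; 1]; [:: 4; 5; 4; 0]; [:: 4; 5; 0; 1];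
  [:: 4; 5; 1]; [:: 5; 4; 2; 0]; [:: 4; 5; 4; 2; 0]; [:: 2]; [:: 5; 4; 0; 1; 0]; [:: 4; 2; 1];
  [:: 4; 5; 4; 2]; [:: 4; 5; 4; 1]; [:: 4; 1; 2]; [:: 3; 4; 0]; [:: 5; 2; 1]; [:: 4; 5; 2; 1];
  [:: 5; 4; 1; 0]; [:: 1; 2]; [:: 3; 4; 0; 1; 0]; [:: 3; 4; 5]; [:: 3; 2]; [:: 5; 3; 4; 1; 0];
  [:: 4; 2; 1; 0]; [:: 5; 4; 0; 1]; [:: 3; 4; 5; 4; 0; 1]; [:: 4; 5; 0; 1; 0]; [:: 5; 3; 2];
  [:: 3; 4; 5; 1]; [:: 5; 1; 2]; [:: 3; 2; 0]; [:: 4; 5; 1; 0]; [:: 5; 3; 4; 0; 1]; [:: 2; 1];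
  [:: 4; 5; 1; 2]; [:: 4; 5; 1; 2; 1]; [:: 5; 3; 2; 0]; [:: 3; 4; 0; 1]; [:: 4; 3; 0; 1; 0];
  [:: 5; 3; 4; 0; 1; 0]; [:: 4; 5; 4; 2; 0; 1; 0]; [:: 4; 3]; [:: 4; 3; 1]; [:: 5; 3; 1; 2];
  [:: 4; 3; 0]; [:: 1; 2; 0]; [:: 4; 5; 4; 0; 1]; [:: 3; 4; 5; 0; 1]; [:: 4; 0; 1; 0];
  [:: 2; 0; 1; 0]; [:: 4; 5; 3]; [:: 3; 4; 5; 4]; [:: 5; 3; 4; 3; 1]; [:: 3; 4; 5; 4; 1];
  [:: 4; 5; 4; 1; 2]; [:: 1; 2; 1]; [:: 4; 5; 4; 1; 2; 1]; [:: 5; 4; 3; 1; 0]; [:: 4; 5; 3; 1; 0];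
  [:: 3; 4; 1; 0]; [:: 5; 1; 2; 1; 0]; [:: 4; 1; 2; 1; 0]; [:: 2; 0; 1]; [:: 4; 2; 0; 1];
  [:: 5; 4; 2; 0; 1]; [:: 3; 4; 5; 4; 0; 1; 0]; [:: 3; 4; 5; 2]; [:: 5; 4; 3; 1]; [:: 3; 1; 2];
  [:: 5; 1; 2; 1]; [:: 4; 1; 2; 1]; [:: 5; 4; 3; 0]; [:: 5; 3; 4; 3; 0]; [:: 3; 4; 5; 4; 0];
  [:: 3; 4; 5; 2; 0]; [:: 4; 5; 4; 1; 0]; [:: 3; 4; 5; 4; 1; 0]; [:: 5; 2; 1; 0];
  [:: 4; 5; 2; 1; 0]; [:: 3; 1; 2; 0]; [:: 1; 2; 1; 0]; [:: 4; 5; 1; 2; 1; 0]; [:: 4; 3; 0; 1];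
  [:: 4; 5; 4; 0; 1; 0]; [:: 4; 5; 3; 0; 1; 0]; [:: 3; 4; 5; 0; 1; 0]; [:: 5; 4; 2; 0; 1; 0];
  [:: 3; 4; 2]; [:: 5; 3; 4; 2]; [:: 4; 5; 3; 1]; [:: 5; 4; 2; 1]; [:: 4; 5; 4; 2; 1];
  [:: 5; 4; 1; 2]; [:: 3; 1; 2; 1]; [:: 4; 5; 3; 0]; [:: 3; 4; 2; 0]; [:: 5; 3; 4; 2; 0];
  [:: 5; 3; 4; 3; 1; 0]; [:: 2; 1; 0]; [:: 4; 5; 1; 2; 0]; [:: 5; 2; 0; 1]; [:: 5; 2; 0; 1; 0];
  [:: 4; 5; 2; 0; 1; 0]; [::]; [:: 5; 4; 3]; [:: 3; 4; 3]; [:: 2; 3]; [:: 4; 5; 3; 4; 1];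
  [:: 3; 2; 1]; [:: 5; 3; 2; 1]; [:: 1; 2; 3]; [:: 3; 4; 3; 0]; [:: 3; 4; 5; 0]; [:: 4; 3; 2; 0];
  [:: 3; 4; 5; 4; 2; 0]; [:: 3; 4; 5; 1; 0]; [:: 5; 1; 2; 0]; [:: 4; 5; 4; 2; 0; 1]].

Definition branching7 : seq nat := [::
  147; 30; 0; 11; 17; 4; 49; 36; 44; 41; 25; 63; 81; 22; 14; 28; 42; 103; 4; 24; 61; 28; 27; 13;
  20; 13; 20; 52; 16; 36; 44; 142; 23; 50; 35; 14; 17; 4; 49; 59; 35; 4; 17; 28; 22; 49; 41; 92;
  38; 24; 2; 32; 53; 5; 22; 17; 49; 52; 36; 44; 34; 39; 23; 50; 16; 35; 32; 21; 47; 32; 23; 50; 16;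
  35; 47; 2; 38; 41; 70; 16; 99; 54; 36; 44; 67; 36; 44; 67; 62; 4; 73; 22; 35; 59; 4; 24; 32; 5;
  83; 7; 15; 87; 4; 19; 26; 12; 10; 33; 28; 29; 31; 27; 15; 7; 45; 42; 72; 58; 7; 0; 12; 4; 19; 26;
  12; 4; 33; 43; 46; 66; 129; 72; 71; 87; 112; 74; 80; 69; 45; 15; 7; 58; 15; 64; 155; 139; 80; 28;
  11; 29; 74; 109; 43; 96; 141; 11; 28; 12; 4; 1; 2; 21; 117; 95; 1; 26; 53; 19; 68; 26; 53; 48;
  41; 19; 21; 2; 53; 26; 111; 116; 101; 53; 68; 115; 96; 7; 43; 101; 115; 116; 96; 7; 43; 81; 63;
  27; 91; 159; 27; 42; 63; 15; 45; 58; 91; 27; 15; 45; 15; 25; 7; 13; 81; 63; 58; 63; 58; 7; 117;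
  13; 69; 76; 27; 7; 33; 1; 2; 21; 24; 12; 14; 28; 13; 25; 65; 152; 153; 13; 7; 10; 15; 12; 4; 28;
  29; 19; 5; 41; 70; 15; 28; 31; 25; 7; 12; 0; 10; 5; 26; 15; 28; 31; 11; 103; 72; 27; 15; 7; 15;
  31; 5; 6; 19; 3; 1; 7; 33; 1; 2; 21; 45; 42; 72; 81; 27; 71; 87; 112; 123; 137; 1; 115; 35; 50;
  8; 22; 16; 52; 8; 22; 29; 27; 11; 13; 20; 5; 6; 19; 3; 1; 7; 11; 5; 6; 19; 3; 1; 29; 27; 20; 13;
  129; 81; 7; 33; 11; 29; 6; 5; 26; 18; 1; 38; 14; 27; 20; 25; 1; 2; 18; 21; 6; 21; 26; 45; 58; 27;
  42; 29; 103; 83; 109; 69; 9; 11; 31; 30; 45; 58; 42; 103; 97; 109; 83; 69; 31; 30; 13; 25; 11;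
  29; 66; 97; 7; 18; 1; 14; 2; 21; 29; 11; 31; 33; 14; 8; 22; 85; 88; 1; 14; 6; 37; 74; 25; 5; 26;
  9; 29; 11; 31; 33; 18; 3; 1; 19; 5; 26; 46; 97; 43; 31; 9; 65; 87; 112; 74; 80; 18; 3; 1; 19; 5;
  26; 30; 13; 25; 11; 29; 52; 14; 3; 8; 21; 2; 32; 53; 90; 8; 38; 3; 21; 2; 47; 51; 39; 36; 146;
  107; 23; 55; 18; 3; 8; 9; 45; 58; 2; 21; 16; 35; 37; 51; 22; 38; 23; 36; 34; 22; 39; 60; 67; 2;
  23; 51; 16; 35; 47; 3; 21; 18; 14; 3; 8; 2; 21; 8; 22; 3; 2; 21; 16; 23; 55; 37; 35; 3; 16; 2;
  47; 36; 39; 2; 21; 47; 39; 51; 23; 84; 108; 36; 34; 18; 8; 22; 38; 3; 2; 21; 18; 3; 8; 1; 14; 2;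
  21; 47; 56; 61; 22; 14; 55; 34; 44; 122; 54; 51; 50; 1; 2; 32; 1; 2; 21; 1; 8; 9; 7; 30; 0; 4; 8;
  17; 14; 8; 22; 1; 3; 2; 7; 33; 43; 8; 14; 5; 8; 19; 6; 41; 14; 3; 12; 4; 0; 10; 4; 0; 10; 14; 8;
  17; 49; 3; 9; 30; 0; 20; 25; 27; 11; 28; 46; 120; 12; 4; 7; 15; 1; 0; 20; 25; 12; 25; 0; 12; 1;
  4; 15; 7; 30; 27; 20; 63; 91; 6; 11; 28; 29; 1; 12; 4; 20; 25; 109; 76; 0; 1; 4; 5; 1; 4; 0; 61;
  56; 10; 10; 1; 26; 1; 28; 6; 19; 11; 6; 19; 7; 15; 9; 29; 15; 7; 9; 30; 5; 0; 4; 35; 144; 106;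
  15; 25; 6; 13; 20; 13; 10; 12; 4; 19; 20; 10; 12; 4; 13; 20; 9; 7; 45; 156; 2; 12; 10; 19; 26; 7;
  33; 43; 8; 14; 2; 7; 9; 26; 11; 31; 19; 0; 10; 28; 13; 25; 31; 13; 25; 7; 33; 9; 45; 58; 13; 25;
  43; 76; 96; 83; 141; 116; 140; 158; 118; 110; 132; 14; 34; 8; 9; 85; 88; 9; 41; 19; 23; 51; 50;
  44; 39; 8; 17; 0; 49; 28; 25; 13; 20; 7; 9; 33; 11; 29; 31; 43; 46; 31; 65; 13; 25; 2; 33; 95;
  13; 25; 83; 76; 65; 110; 118; 139; 23; 136; 12; 14; 14; 98; 12; 50; 51; 14; 134; 135; 121; 59; 4;
  0; 24; 3; 29; 5; 18; 6; 31; 42; 17; 40; 18; 27; 18; 13; 20; 6; 19; 31; 66; 13; 29; 27; 46; 17;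
  40; 6; 14; 18; 8; 68; 53; 90; 42; 27; 123; 89; 19; 13; 20; 29; 31; 87; 18; 3; 1; 24; 71; 52; 16;
  32; 56; 123; 137; 31; 29; 66; 46; 0; 18; 14; 17; 8; 3; 1; 1; 3; 20; 25; 27; 11; 31; 6; 1; 5; 26;
  48; 92; 6; 5; 26; 17; 24; 31; 46; 13; 20; 42; 14; 22; 6; 92; 24; 2; 32; 10; 29; 11; 31; 12; 18;
  1; 25; 13; 20; 18; 3; 1; 24; 61; 2; 32; 1; 32; 36; 22; 38; 47; 68; 127; 52; 16; 44; 37; 52; 16;
  23; 16; 52; 37; 121; 77; 50; 51; 22; 8; 47; 22; 8; 38; 52; 73; 0; 0; 160; 113; 16; 23; 55; 36;
  44; 37; 3; 18; 32; 21; 52; 8; 3; 19; 5; 26; 5; 26; 14; 48; 17; 10; 41; 17; 10; 3; 3; 21; 2; 32;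
  18; 3; 150; 36; 8; 14; 16; 35; 37; 51; 38; 14; 23; 36; 34; 39; 60; 67; 32; 2; 16; 37; 35; 18; 14;
  3; 8; 2; 21; 8; 38; 3; 2; 21; 16; 23; 55; 37; 35; 39; 2; 32; 36; 34; 2; 21; 47; 39; 51; 23; 84;
  108; 36; 34; 18; 8; 38; 3; 2; 22; 48; 92; 3; 2; 32; 52; 3; 9; 30; 0; 20; 25; 27; 11; 28; 46; 120;
  12; 4; 7; 15; 20; 25; 0; 10; 25; 10; 0; 15; 7; 30; 27; 20; 63; 91; 38; 6; 5; 68; 53; 1; 5; 40; 0;
  10; 92; 6; 41; 48; 5; 41; 48; 5; 1; 5; 6; 53; 68; 1; 6; 11; 28; 29; 7; 15; 9; 5; 26; 5; 26; 0; 5;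
  6; 26; 4; 5; 6; 19; 53; 90; 16; 18; 0; 1; 12; 10; 62; 73; 2; 7; 15; 9; 0; 6; 1; 5; 2; 7; 33; 45;
  29; 43; 11; 37; 44; 34; 39; 35; 23; 50; 34; 32; 114; 79; 57; 78; 57; 78; 0; 57; 105; 143; 1; 12;
  4; 62; 73; 47; 56; 21; 24; 0; 4; 44; 39; 77; 59; 54; 37; 1; 0; 18; 34; 106; 18; 0; 6; 114; 105;
  57; 54; 60; 34; 122; 60; 34; 122; 16; 0; 18; 6; 1; 5; 18; 1; 59; 106; 39; 51; 34; 55; 2; 7; 15;
  33; 45; 29; 43; 11; 18; 9; 59; 37; 44; 39; 108; 54; 60; 84; 130; 54; 60; 84; 130; 37; 44; 39; 34;
  142; 114; 57; 78; 125; 146; 67; 55; 23; 50; 18; 2; 30; 9; 15; 7; 13; 10; 4; 27; 13; 10; 4; 20; 0;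
  10; 12; 0; 10; 0; 10; 3; 4; 21; 24; 56; 0; 10; 6; 0; 3; 5; 4; 40; 12; 49; 12; 3; 5; 0; 10; 4; 0;
  2; 20; 27; 28; 11; 31; 11; 31; 21; 41; 44; 88; 24; 56; 48; 70; 10; 12; 4; 31; 13; 83; 76; 25; 69;
  27; 69; 43; 33; 101; 111; 24; 61; 24; 61; 76; 27; 25; 15; 9; 27; 5; 53; 68; 28; 24; 0; 42; 9; 30;
  46; 33; 95; 46; 33; 30; 42; 64; 0; 17; 6; 19; 30; 15; 9; 40; 10; 33; 95; 15; 117; 46; 97; 15;
  140; 80; 71; 65; 132; 71; 65; 9; 19; 5; 26; 0; 10; 28; 12; 42; 9; 30; 13; 25; 0; 17; 40; 66; 46;
  0; 24; 26; 19; 53; 61; 119; 26; 6; 19; 30; 15; 9; 13; 20; 15; 29; 11; 46; 66; 33; 64; 43; 91;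
  129; 63; 13; 20; 9; 11; 29; 20; 30; 64; 58; 15; 5; 11; 28; 29; 64; 45; 42; 72; 42; 72; 0; 24; 17;
  40; 131; 42; 149; 6; 11; 28; 29; 19; 11; 68; 53; 24; 61; 28; 20; 27; 148; 24; 12; 23; 14; 38; 49;
  23; 52; 71; 65; 64; 14; 22; 55; 51; 50; 38; 101; 111; 24; 12; 119; 30; 11; 28; 9; 9; 64; 42; 72;
  28; 9; 30; 12; 0; 24; 26; 6; 19; 11; 9; 30; 18; 9; 30; 58; 45; 13; 81; 63; 69; 120; 66; 46; 20;
  27; 13; 20; 30; 43; 69; 76; 33; 71; 65; 74; 80; 74; 80; 21; 12; 10; 40; 41; 70; 24; 61; 19; 6;
  26; 33; 30; 43; 9; 64; 45; 43; 11; 66; 46; 30; 9; 74; 118; 131; 110; 14; 8; 10; 17; 40; 52; 23;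
  36; 34; 32; 17; 86; 57; 40; 10; 75; 40; 12; 10; 47; 56; 24; 73; 49; 17; 62; 51; 50; 36; 34; 36;
  39; 60; 67; 37; 35; 39; 77; 59; 54; 67; 36; 34; 36; 38; 88; 138; 17; 102; 86; 82; 151; 32; 49;
  56; 119; 128; 82; 126; 49; 75; 94; 128; 82; 126; 17; 40; 126; 40; 17; 86; 85; 94; 102; 157; 82;
  94; 138; 82; 85; 41; 48; 6; 3; 22; 90; 127; 127; 22; 90; 3; 6; 5; 22; 48; 70; 48; 49; 17; 40; 50;
  22; 41; 86; 57; 34; 94; 102; 85; 88; 48; 70; 48; 70; 17; 48; 41; 70; 3; 10; 4; 4; 6; 5; 35; 16;
  23; 55; 23; 55; 99; 121; 37; 16; 35; 59; 16; 93; 145; 59; 16; 145; 93; 106; 84; 108; 124; 105;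
  62; 125; 79; 89; 104; 62; 100; 89; 98; 17; 22; 75; 62; 73; 57; 79; 78; 143; 124; 62; 89; 17; 49;
  22; 75; 98; 100; 105; 79; 62; 17; 28; 4; 22; 154; 57; 75; 12; 40; 24; 61; 40; 75; 57; 79; 100;
  136; 44; 37; 35; 34; 16; 144; 93; 39; 51; 54; 60; 77; 93; 59; 130; 84; 161; 23; 34; 22; 32; 21;
  47; 16; 23; 55; 37; 35; 8; 17; 54; 107; 60; 77; 16; 50; 37; 35; 23; 16; 37; 35; 107; 54; 60; 8;
  41; 48; 17; 8; 32; 41; 48; 86; 38; 133; 102; 38; 82; 78; 133; 128; 38; 47; 56; 24; 4; 26; 6; 19;
  44; 54; 67; 99; 113; 104; 89; 134; 23; 16; 37; 54; 77; 16; 93; 107; 99; 124; 104; 79; 125; 8; 40;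
  49; 75; 2; 32; 24; 56; 78; 57; 98; 100; 135; 32; 23; 47; 113; 104; 73; 24; 56].

(** * Evaluation of the two branchings, and the five bounds *)

Lemma refute_sample6 :
  refute 6 (near_pairs 6) sample6 100 2 [::] trie0 branching6 = Some [::].
Proof. by vm_compute. Qed.

Lemma refute_sample7 :
  refute 7 (near_pairs 7) sample7 100 1 [::] trie0 branching7 = Some [::].
Proof. by vm_compute. Qed.

Theorem theorem3p5 :
  [/\ P_le 6 3 116,
      P_le 7 3 716,
      P_le 11 3 (10`! - 10),
      P_le 13 3 (12`! - 12)
    & P_le 17 3 (16`! - 5)].
Proof.
split=> C codeC.
(* At least 19 permutations are uncovered, so [6 * c <= 701]. *)
- have num c : 2 * 720 <= 78 * (720 - 6 * c) -> c <= 116 by lia.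
  exact: num (sample_bound codeC refute_sample6).
(* Here [7 * 720] is [7!]; at least 32 permutations are uncovered, so [7 * c <= 5008]. *)
- have num c : 1 * (7 * 720) <= 162 * (7 * 720 - 7 * c) -> c <= 716 by lia.
  exact: num (sample_bound codeC refute_sample7).
- exact: card_code_prime codeC.
- exact: card_code_prime codeC.
(* The general prime bound is stronger than the one claimed for 17. *)
- have le_C : #|C| <= 16`! - 16 by exact: card_code_prime codeC.
  by apply: leq_trans le_C _; apply: leq_sub2l.
Qed.
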